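(* Let $R$ be a prime ring and let $I$ be a nonzero left ideal of $R$. Let $F$, $G$ and $H$ be generalized derivations of $R$ associated to derivations $f$, $g$ and $h$ of $R$, respectively, such that $F(x)G(y)-H(xy)\in Z(R)$ for all $x,y\in I$. Then $R$ is commutative, or $If(I)=0$, or $Ig(I)=0$.
   Context: Rings are associative (not assumed unital or commutative); $Z(R)$ is the center of $R$. $R$ is prime if for $a,b\in R$, $aRb=\{0\}$ implies $a=0$ or $b=0$. A derivation of $R$ is an additive map $d:R\to R$ with $d(xy)=d(x)y+xd(y)$ for all $x,y\in R$. A generalized derivation of $R$ associated to a derivation $d$ of $R$ is an additive map $F:R\to R$ with $F(xy)=F(x)y+xd(y)$ for all $x,y\in R$. For a derivation $d$, $Id(I)=0$ means $u\,d(v)=0$ for all $u,v\in I$. *)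

(* Defs.v *)
From HB Require Import structures.
From mathcomp Require Import all_boot all_algebra.
From mathcomp Require Import classical_sets.

Set Implicit Arguments.
Unset Strict Implicit.
Unset Printing Implicit Defensive.

Local Open Scope classical_set_scope.
Local Open Scope ring_scope.

(* MathComp's pzRingType has a unit, so rings not assumed unital are built here
   from zmodType and semigroupType. Their product is that of semigroupType; it
   gets its own infix because the arguments of +%R are parsed in ring_scope,
   where x * y is the product of a unital ring. *)
Notation "x ** y" := (monoid.mul x y) (at level 40, left associativity) : ring_scope.

HB.mixin Record Zmodule_Semigroup_isRng R of GRing.Zmodule R & Semigroup R := {
  rng_mulDl : forall x y z : R, (x + y) ** z = x ** z + y ** z;
  rng_mulDr : forall x y z : R, x ** (y + z) = x ** y + x ** z
}.

#[short(type="rngType")]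
HB.structure Definition Rng :=
  { R of GRing.Zmodule R & Semigroup R & Zmodule_Semigroup_isRng R }.

Definition rng_center (R : rngType) : set R :=
  [set z | forall x : R, commute z x].
Arguments rng_center R : clear implicits.

Definition rng_commutative (R : rngType) : Prop := forall x y : R, commute x y.

Definition prime_rng (R : rngType) : Prop :=
  forall a b : R, (forall r : R, a ** r ** b = 0) -> a = 0 \/ b = 0.

Definition left_ideal (R : rngType) (I : set R) : Prop :=
  [/\ I 0, forall x y, I x -> I y -> I (x - y)
         & forall r x, I x -> I (r ** x)].

Definition derivation (R : rngType) (d : {additive R -> R}) : Prop :=
  forall x y : R, d (x ** y) = d x ** y + x ** d y.

Definition generalized_derivation (R : rngType) (F d : {additive R -> R}) :
    Prop :=
  derivation d /\ forall x y : R, F (x ** y) = F x ** y + x ** d y.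

(* Main.v *)
Require Import Defs.
From mathcomp Require Import all_boot all_algebra.
From mathcomp Require Import boolp classical_sets.

Set Implicit Arguments.
Unset Strict Implicit.
Unset Printing Implicit Defensive.

Import GRing.Theory.

Local Open Scope classical_set_scope.
Local Open Scope ring_scope.

(** Write Q(x,y,z) = F(x) y g(z) - x y h(z). Comparing the hypothesis at (x,yz)
    with its product at (x,y) by z shows that Q(x,y,z) commutes with z, and hence
    so does Q(xw,y,z) - Q(x,wy,z) = x f(w) y g(z), for all x, y, z, w in I.
    Replacing x by rx gives [r,z] x f(w) y g(z) = 0, so primeness yields, unless
    I f(I) = 0, that every z in I is central or satisfies I g(z) = 0. A group
    is not the union of two proper subgroups, so one of the two alternatives
    holds on all of I, and a nonzero central left ideal makes R commutative. *)

Section Rng.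
Variable R : rngType.
Implicit Types (a b c x y z : R) (I : set R).

Lemma rng_mul0r x : 0 ** x = 0.
Proof. by apply: (addrI (0 ** x)); rewrite -rng_mulDl !addr0. Qed.

Lemma rng_mulr0 x : x ** 0 = 0.
Proof. by apply: (addrI (x ** 0)); rewrite -rng_mulDr !addr0. Qed.

Lemma rng_mulNr x y : (- x) ** y = - (x ** y).
Proof. by apply: (addrI (x ** y)); rewrite -rng_mulDl !subrr rng_mul0r. Qed.

Lemma rng_mulrN x y : x ** (- y) = - (x ** y).
Proof. by apply: (addrI (x ** y)); rewrite -rng_mulDr !subrr rng_mulr0. Qed.

Lemma rng_mulBl x y z : (x - y) ** z = x ** z - y ** z.
Proof. by rewrite rng_mulDl rng_mulNr. Qed.

Lemma rng_mulBr x y z : x ** (y - z) = x ** y - x ** z.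
Proof. by rewrite rng_mulDr rng_mulrN. Qed.

Lemma rng_mulA x y z : x ** (y ** z) = x ** y ** z.
Proof. exact: mulgA. Qed.

Lemma commuteB a b z : commute a z -> commute b z -> commute (a - b) z.
Proof. by rewrite /commute rng_mulBl rng_mulBr => -> ->. Qed.

(** For [x] in [I], every [r ** x] is again in [I], so [a ** r ** (x ** b) = 0] for all [r], and
    primeness applies to the pair [a], [x ** b]. *)
Lemma prime_left_ideal I a b : prime_rng R -> left_ideal I ->
  (forall x, I x -> a ** x ** b = 0) -> a = 0 \/ forall x, I x -> x ** b = 0.
Proof.
move=> primeR [_ _ I_mul] aIb0; have [|a_neq0] := pselect (a = 0); first by left.
right=> x Ix; have [//|//] : a = 0 \/ x ** b = 0.
by apply: primeR => r; rewrite rng_mulA -(rng_mulA a) aIb0 //; apply: I_mul.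
Qed.

Lemma central_left_ideal_commutative I : prime_rng R -> left_ideal I ->
  I <> [set 0] -> I `<=` rng_center R -> rng_commutative R.
Proof.
move=> primeR idI I_neq0 IZ r s; have [I0 _ I_mul] := idI.
have [z Iz z_neq0] : exists2 z, I z & z <> 0.
  apply: contrapT => noz; apply: I_neq0; apply/seteqP; split=> [z Iz|_ -> //].
  by apply: contrapT => z_neq0; apply: noz; exists z.
have [/eqP|//] : r ** s - s ** r = 0 \/ z = 0; last by rewrite subr_eq0 => /eqP.
(* Both [t ** z] and [r ** (t ** z)] lie in [I], hence are central, so
   [r s t z = r (t z) s = s r t z]. *)
apply: primeR => t; rewrite -rng_mulA; have Itz := I_mul t _ Iz.
rewrite rng_mulBl -!rng_mulA -(IZ _ Itz s) -(IZ _ (I_mul r _ Itz) s).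
by rewrite -!rng_mulA subrr.
Qed.

End Rng.

Lemma subgroup_cover (V : zmodType) (I A B : set V) :
  (forall x y, I x -> I y -> I (x - y)) ->
  (forall x y, A x -> A y -> A (x - y)) ->
  (forall x y, B x -> B y -> B (x - y)) ->
  I `<=` A `|` B -> I `<=` A \/ I `<=` B.
Proof.
move=> IB AB BB IAB; have [|nIA] := pselect (I `<=` A); first by left.
have [x Ix nAx] : exists2 x, I x & ~ A x.
  apply: contrapT => nox; apply: nIA => x Ix.
  by apply: contrapT => nAx; apply: nox; exists x.
have Bx : B x by case: (IAB x Ix).
right=> y Iy; case: (IAB y Iy) => // Ay.
(* Since [y] is in [A] and [x] is not, [y - x] cannot be in [A]. *)
case: (IAB _ (IB _ _ Iy Ix)) => [Ayx|Byx].
  by case: nAx; rewrite -(subKr y x); apply: AB.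
(* With closure under subtraction only, [- x] is reached as [(x - x) - x], and [y] as
   [(y - x) - (- x)]. *)
have := BB _ _ Byx (BB _ _ (BB _ _ Bx Bx) Bx).
by rewrite subrr sub0r opprK subrK.
Qed.

Section GeneralizedDerivations.
Variables (R : rngType) (I : set R) (F G H f g h : {additive R -> R}).
Hypotheses (idI : left_ideal I) (primeR : prime_rng R).
Hypotheses (genF : generalized_derivation F f) (genG : generalized_derivation G g).
Hypothesis genH : generalized_derivation H h.
Hypothesis FGH : forall x y : R, I x -> I y ->
  rng_center R (F x ** G y - H (x ** y)).

Lemma commute_FgBh x y z : I x -> I y -> I z ->
  commute (F x ** y ** g z - x ** y ** h z) z.
Proof.
move=> Ix Iy Iz; have [_ _ I_mul] := idI.
have -> : F x ** y ** g z - x ** y ** h z =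
    (F x ** G (y ** z) - H (x ** (y ** z))) - (F x ** G y - H (x ** y)) ** z.
  rewrite genG.2 rng_mulA genH.2 rng_mulDr rng_mulBl !rng_mulA.
  by rewrite [- (_ + x ** y ** h z)]opprD addrACA [RHS]addrC addKr.
(* The first difference is central; the second term is a central element times [z], which still
   commutes with [z]. *)
apply: commuteB; first by apply: FGH => //; apply: I_mul.
by rewrite /commute [RHS]rng_mulA -(FGH Ix Iy z).
Qed.

Lemma commute_fg x w y z : I x -> I w -> I y -> I z ->
  commute (x ** f w ** y ** g z) z.
Proof.
move=> Ix Iw Iy Iz; have [_ _ I_mul] := idI.
(* By associativity the two [h] terms cancel, and expanding [F (x ** w)] leaves only the term in
   [f w]. *)
have -> : x ** f w ** y ** g z =
    (F (x ** w) ** y ** g z - x ** w ** y ** h z)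
    - (F x ** (w ** y) ** g z - x ** (w ** y) ** h z).
  rewrite genF.2 !rng_mulA opprB addrA subrK !rng_mulDl.
  by rewrite addrAC subrr add0r.
by apply: commuteB; apply: commute_FgBh => //; apply: I_mul.
Qed.

(** Put [p = x ** f w ** y ** g z]. Both [p] and [r ** p] commute with [z], the latter because
    [r ** x] is in [I]; so [r z p = r p z = z r p]. *)
Lemma commutator_fg_eq0 r x w y z : I x -> I w -> I y -> I z ->
  (r ** z - z ** r) ** x ** (f w ** y ** g z) = 0.
Proof.
move=> Ix Iw Iy Iz; have [_ _ I_mul] := idI.
rewrite !rng_mulA !rng_mulBl; apply/eqP; rewrite subr_eq0; apply/eqP.
rewrite -!rng_mulA (rng_mulA z r) !rng_mulA.
have := commute_fg (I_mul r _ Ix) Iw Iy Iz; rewrite /commute !rng_mulA => <-.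
by have := commute_fg Ix Iw Iy Iz; rewrite /commute -!rng_mulA => ->.
Qed.

Lemma central_or_annihilated u v : I u -> I v -> u ** f v <> 0 ->
  I `<=` rng_center R `|` [set z | forall x, I x -> x ** g z = 0].
Proof.
move=> Iu Iv ufv_neq0 z Iz.
have [|nIg] := pselect (forall x, I x -> x ** g z = 0); first by right.
left=> r; apply: contrapT => zr.
(* Primeness acts twice: the nonzero left factor [r ** z - z ** r] gives this equation, then the
   nonzero left factor [u ** f v] gives a contradiction with [nIg]. *)
have ufvIg y : I y -> u ** f v ** y ** g z = 0.
  move=> Iy.
  have [|/eqP|Ifv0] := @prime_left_ideal R I (r ** z - z ** r)
    (f v ** y ** g z) primeR idI.
  - by move=> x Ix; apply: commutator_fg_eq0.
  - by rewrite subr_eq0 => /eqP /esym.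
  - by have := Ifv0 u Iu; rewrite !rng_mulA.
by case: (prime_left_ideal primeR idI ufvIg).
Qed.

End GeneralizedDerivations.

Theorem theorem3p1 (R : rngType) (I : set R)
    (F G H f g h : {additive R -> R}) :
  prime_rng R ->
  left_ideal I -> I <> [set 0] ->
  generalized_derivation F f ->
  generalized_derivation G g ->
  generalized_derivation H h ->
  (forall x y : R, I x -> I y -> rng_center R (F x ** G y - H (x ** y))) ->
  [\/ rng_commutative R,
      forall u v : R, I u -> I v -> u ** f v = 0
    | forall u v : R, I u -> I v -> u ** g v = 0].
Proof.
move=> primeR idI I_neq0 genF genG genH FGH; have [_ IB _] := idI.
have [|nIf] := pselect (forall u v : R, I u -> I v -> u ** f v = 0).
  exact: Or32.
have [u [v [Iu Iv ufv_neq0]]] : exists u v, [/\ I u, I v & u ** f v <> 0].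
  apply: contrapT => nouv; apply: nIf => u v Iu Iv.
  by apply: contrapT => ufv_neq0; apply: nouv; exists u, v.
have Icover := central_or_annihilated idI primeR genF genG genH FGH Iu Iv ufv_neq0.
have [|//|IZ|Ig0] := subgroup_cover IB _ _ Icover.
- by move=> x y Zx Zy r; apply: commuteB.
- by move=> x y gx0 gy0 w Iw; rewrite raddfB rng_mulBr gx0 // gy0 // subrr.
- by apply: Or31; apply: central_left_ideal_commutative IZ.
- by apply: Or33 => w z Iw Iz; apply: Ig0.
Qed.
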